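(* Let $d\ge1$. For smooth $l$-forms $\omega$ on the unit cube, $0\le l\le d$, it holds that \[ \mathrm d\mathcal H\omega+\mathcal H\mathrm d\omega=\omega-\mathcal P\omega. \]
   Context: $\Omega=(0,1)^d$, $[d]=\{1,\dots,d\}$. For $I=\{i_1<\dots<i_l\}\subseteq[d]$ put $\mathrm dx_I=\mathrm dx_{i_1}\wedge\cdots\wedge\mathrm dx_{i_l}$. A smooth $l$-form is $\omega=\sum_{|I|=l}u_I\,\mathrm dx_I$ with $u_I\in C^\infty([0,1]^d)$; its exterior derivative is $\mathrm d\omega=\sum_{|I|=l}\sum_{j\notin I}\partial_{x_j}u_I\,\mathrm dx_j\wedge\mathrm dx_I$ ($\mathrm d=0$ on $d$-forms). For $q\in L^2(0,1)$ let $Aq(x)=\int_0^xq(t)\,\mathrm dt-\int_0^1\int_0^yq(t)\,\mathrm dt\,\mathrm dy$, and let $A_i$ be $A$ acting only in the variable $x_i$. For $i\in[d]$ define, extended linearly to forms: $p_i(u_I\,\mathrm dx_I)=\big(\int_0^1u_I(x_1,\dots,t,\dots,x_d)\,\mathrm dt\big)\mathrm dx_I$ ($t$ in the $i$th slot) if $i\notin I$, and $p_i(u_I\,\mathrm dx_I)=0$ if $i\in I$; $h_i(u_I\,\mathrm dx_I)=0$ if $i\notin I$, and $h_i(u_I\,\mathrm dx_I)=(-1)^{r-1}(A_iu_I)\,\mathrm dx_{I\setminus\{i\}}$ if $i=i_r$ is the $r$th element of the ordered set $I$. Put $P_{<1}=\mathrm{id}$, $P_{<i}=p_1\cdots p_{i-1}$,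 $\mathcal H=\sum_{i=1}^dP_{<i}h_i$ (so $\mathcal H=0$ on $0$-forms), and $\mathcal P=p_1p_2\cdots p_d$ (so $\mathcal P$ vanishes on $l$-forms with $l\ge1$ and $\mathcal Pv=\int_\Omega v\,\mathrm d\boldsymbol x$ as a constant function for a $0$-form $v$). *)

(* Defs.v *)
From mathcomp Require Import all_boot all_order all_algebra.
From mathcomp Require Import all_classical all_reals all_analysis.

Set Implicit Arguments.
Unset Strict Implicit.
Unset Printing Implicit Defensive.

Import Order.TTheory GRing.Theory Num.Theory.
Import numFieldNormedType.Exports.

Local Open Scope classical_set_scope.
Local Open Scope ring_scope.

(* Functions on the closed cube [0,1]^d are represented by functions on
   'rV[R]_d.  Every notion below reads them on the cube only, and forms are
   compared on the cube only.  Coordinates are numbered 0, ..., d-1. *)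

Definition cube (R : realType) (d : nat) : set 'rV[R]_d :=
  [set x | forall i, 0 <= x 0 i <= 1].

Definition upd (R : realType) (d : nat) (x : 'rV[R]_d) (i : 'I_d) (t : R) :
  'rV[R]_d := \row_k (if k == i then t else x 0 k).

Definition slope01 (R : realType) (f : R -> R) (t : R) : R -> R :=
  fun s => (f s - f t) / (s - t).

(* Derivative relative to [0,1]: the usual derivative at interior points, the
   one-sided derivative at 0 and 1. *)
Definition derivable01 (R : realType) (f : R -> R) (t : R) : Prop :=
  cvg (slope01 f t @ within `[0, 1] t^').

Definition derive01 (R : realType) (f : R -> R) (t : R) : R :=
  lim (slope01 f t @ within `[0, 1] t^').

Definition partial (R : realType) (d : nat) (j : 'I_d) (u : 'rV[R]_d -> R) :
  'rV[R]_d -> R := fun x => derive01 (fun t => u (upd x j t)) (x 0 j).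

(* C^oo([0,1]^d): the iterated partial derivatives of all orders exist and are
   continuous on the closed cube. *)
Definition smooth (R : realType) (d : nat) (u : 'rV[R]_d -> R) : Prop :=
  forall s : seq 'I_d, let v := foldr (@partial R d) u s in
    {within @cube R d, continuous v} /\
    (forall (j : 'I_d) (x : 'rV[R]_d), cube x ->
       derivable01 (fun t => v (upd x j t)) (x 0 j)).

(* omega I is the coefficient u_I of dx_I; forms of mixed degree are allowed. *)
Definition diff_form (R : realType) (d : nat) : Type :=
  {set 'I_d} -> 'rV[R]_d -> R.

Definition smooth_form (R : realType) (d l : nat) (omega : diff_form R d) : Prop :=
  forall I : {set 'I_d},
    (#|I| = l -> smooth (omega I)) /\
    (#|I| <> l -> forall x, cube x -> omega I x = 0).

Definition eq_form (R : realType) (d : nat) (omega eta : diff_form R d) : Prop :=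
  forall (I : {set 'I_d}) (x : 'rV[R]_d), cube x -> omega I x = eta I x.

(* u dx_I *)
Definition monoform (R : realType) (d : nat) (u : 'rV[R]_d -> R)
  (I : {set 'I_d}) : diff_form R d := fun J => if J == I then u else 0.

(* If i is the r-th element of I (r >= 1), this is r - 1. *)
Definition nbefore (d : nat) (i : 'I_d) (I : {set 'I_d}) : nat :=
  #|[set k in I | (k < i)%N]%SET|.

(* dx_j /\ (u dx_I); it is 0 if j \in I, and otherwise the sign comes from
   moving dx_j past the dx_k with k \in I and k < j. *)
Definition wedge_dx (R : realType) (d : nat) (j : 'I_d) (u : 'rV[R]_d -> R)
  (I : {set 'I_d}) : diff_form R d :=
  if j \in I then 0
  else monoform (fun x => (-1) ^+ nbefore j I * u x) (j |: I)%SET.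

Definition ext_d (R : realType) (d : nat) (omega : diff_form R d) : diff_form R d :=
  \sum_(I : {set 'I_d}) \sum_(j | j \notin I)
    wedge_dx j (partial j (omega I)) I.

Definition Aop (R : realType) (q : R -> R) (x : R) : R :=
  (\int[lebesgue_measure]_(t in `[0, x]) q t) -
  \int[lebesgue_measure]_(y in `[0, 1])
    (\int[lebesgue_measure]_(t in `[0, y]) q t).

Definition Aop_i (R : realType) (d : nat) (i : 'I_d) (u : 'rV[R]_d -> R) :
  'rV[R]_d -> R := fun x => Aop (fun t => u (upd x i t)) (x 0 i).

Definition mean_i (R : realType) (d : nat) (i : 'I_d) (u : 'rV[R]_d -> R) :
  'rV[R]_d -> R :=
  fun x => \int[lebesgue_measure]_(t in `[0, 1]) u (upd x i t).

Definition p_op (R : realType) (d : nat) (i : 'I_d) (omega : diff_form R d) :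
  diff_form R d :=
  \sum_(I : {set 'I_d} | i \notin I) monoform (mean_i i (omega I)) I.

Definition h_op (R : realType) (d : nat) (i : 'I_d) (omega : diff_form R d) :
  diff_form R d :=
  \sum_(I : {set 'I_d} | i \in I)
    monoform (fun x => (-1) ^+ nbefore i I * Aop_i i (omega I) x)
      (I :\ i)%SET.

(* The composition of the p_k with k < m, the one of smallest index outermost. *)
Definition p_prod (R : realType) (d m : nat) : diff_form R d -> diff_form R d :=
  \big[(fun F G => F \o G)/idfun]_(k < d | (k < m)%N) @p_op R d k.

Definition H_op (R : realType) (d : nat) (omega : diff_form R d) : diff_form R d :=
  \sum_(i < d) p_prod i (h_op i omega).

Definition P_op (R : realType) (d : nat) : diff_form R d -> diff_form R d :=
  @p_prod R d d.

(* Main.v *)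
Require Import Defs.
From mathcomp Require Import all_boot all_order all_algebra.
From mathcomp Require Import all_classical all_reals all_analysis.
From mathcomp Require Import ring lra.

(* On smooth forms each [h_op i] is a homotopy, [d h_i + h_i d = id - p_i]: the
   coefficients on [dx_I] with [i \in I] give [partial_i A_i u = u], those with
   [i \notin I] give [A_i (partial_i u) = u - mean_i u], and all mixed terms
   cancel in pairs because [partial_j] commutes with [A_i] for [j <> i] while
   the signs are opposite.  Since [d] also commutes with each [p_i], composing
   with [p_0 ... p_(i-1)] and summing over [i] makes the right-hand sides
   telescope to [id - p_0 ... p_(d-1)]. *)

Set Implicit Arguments.
Unset Strict Implicit.
Unset Printing Implicit Defensive.

Import Order.TTheory GRing.Theory Num.Theory.
Import numFieldNormedType.Exports.

Local Open Scope classical_set_scope.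
Local Open Scope ring_scope.

(** * Calculus on [0,1] with one-sided derivatives at the endpoints *)

Section UnitInterval.
Variable R : realType.
Implicit Types (f g : R -> R) (t s x e : R).

(** [derive01] and the integrals are total functions with default values, and coefficients are
    controlled on the cube only. The proof therefore uses relations that assert existence and value
    together ([has_derive01], [has_partial]) and carries smoothness of the coefficients through
    every operator. The analysis rests on one estimate, for increments of [int0 f], together with
    the mean value theorem and uniform continuity on the compact cube; they yield the fundamental
    theorem of calculus up to the endpoints and differentiation under the integral sign. Since
    [A_i u] is a primitive minus its mean in [x_i], facts about [A_i] reduce to these two
    operators. *)

Lemma continuous01P f :
  {within `[0, 1], continuous f} <->
  forall t, 0 <= t <= 1 -> forall e, 0 < e -> exists2 r, 0 < r &
    forall s, 0 <= s <= 1 -> `|t - s| < r -> `|f t - f s| < e.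
Proof.
rewrite subspace_continuousP; split=> [cf t t01 e e0|cf t].
  have /cf/cvgrPdist_lt/(_ e e0) : `[0, 1]%classic t by rewrite /= in_itv.
  rewrite near_withinE near_nbhs => /nbhs_ballP[r /= r0 rP].
  by exists r => // s s01 ts; apply: (rP s) => //=; rewrite in_itv.
rewrite /= in_itv /= => t01; apply/cvgrPdist_lt => e e0.
have [r r0 rP] := cf t t01 e e0.
rewrite near_withinE near_nbhs; apply/nbhs_ballP; exists r => //= s ts.
by rewrite in_itv /= => s01; apply: rP.
Qed.

(** Multiplying out the difference quotient admits [s = t] and lets integral estimates apply without
    division. *)
Definition has_derive01 f t l :=
  forall e, 0 < e -> exists2 r, 0 < r &
    forall s, 0 <= s <= 1 -> `|t - s| < r ->
      `|f s - f t - l * (s - t)| <= e * `|s - t|.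

Lemma has_derive01_cvg f t l :
  has_derive01 f t l <-> slope01 f t @ within `[0, 1] t^' --> l.
Proof.
split=> [fl|/cvgrPdist_le fl].
  apply/cvgrPdist_le => e e0; have [r r0 rP] := fl e e0.
  rewrite near_withinE near_withinE near_nbhs; apply/nbhs_ballP.
  exists r => //= s ts st; rewrite in_itv /= => s01.
  have st0 : s - t != 0 by rewrite subr_eq0.
  have := rP s s01 ts.
  rewrite -ler_pdivrMr ?normr_gt0// -normf_div.
  by rewrite mulrBl mulfK// distrC /slope01.
move=> e e0; have := fl e e0.
rewrite near_withinE near_withinE near_nbhs => /nbhs_ballP[r /= r0 rP].
exists r => // s s01 ts.
have [->|st] := eqVneq s t; first by rewrite !subrr mulr0 subrr normr0 mulr0.
have st0 : s - t != 0 by rewrite subr_eq0.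
have := rP s ts st; rewrite /= in_itv /= => /(_ s01).
move=> H; rewrite -ler_pdivrMr ?normr_gt0// -normf_div.
by rewrite mulrBl mulfK// distrC.
Qed.

(** Every point of [0,1] is an accumulation point of it; this makes the limit defining [derive01]
    unique. *)
Lemma within01_dnbhs_proper t : 0 <= t <= 1 ->
  ProperFilter (within `[0, 1] t^').
Proof.
move=> /andP[t0 t1]; apply: Build_ProperFilter_ex => P FP.
have : \forall s \near within `[0, 1] t^', P s by [].
rewrite near_withinE near_withinE near_nbhs => /nbhs_ballP[r /= r0 rP].
(* Moving towards the farther endpoint, a displacement of at most 1/2 stays in [0,1]. *)
have [t12|t12] := leP t (1/2).
  exists (t + Num.min (r / 2) (1 / 2)).
  have [m0 [m1 m2]] : 0 < Num.min (r / 2) (1 / 2) /\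
     Num.min (r / 2) (1 / 2) < r /\ Num.min (r / 2) (1 / 2) <= 1/2.
    by rewrite /Num.min; case: ifP => h; lra.
  apply: rP; rewrite /ball /=.
  - by rewrite opprD addNKr normrN gtr0_norm.
  - by apply/eqP; lra.
  - by rewrite in_itv /=; lra.
exists (t - Num.min (r / 2) (1 / 2)).
have [m0 [m1 m2]] : 0 < Num.min (r / 2) (1 / 2) /\
   Num.min (r / 2) (1 / 2) < r /\ Num.min (r / 2) (1 / 2) <= 1/2.
  by rewrite /Num.min; case: ifP => h; lra.
apply: rP; rewrite /ball /=.
- by rewrite opprB addrC subrK gtr0_norm.
- by apply/eqP; lra.
- by rewrite in_itv /=; lra.
Qed.

Lemma has_derive01_derivable f t l : has_derive01 f t l -> derivable01 f t.
Proof. by move=> /has_derive01_cvg fl; apply/cvg_ex; exists l. Qed.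

Lemma has_derive01_derive01 f t l : 0 <= t <= 1 ->
  has_derive01 f t l -> derive01 f t = l.
Proof.
move=> /within01_dnbhs_proper FF /has_derive01_cvg.
exact: (cvg_lim (@Rhausdorff R)).
Qed.

Lemma derivable01_has_derive f t :
  derivable01 f t -> has_derive01 f t (derive01 f t).
Proof. by move=> h; apply/has_derive01_cvg. Qed.

Lemma has_derive01_ext f g t l : 0 <= t <= 1 ->
  (forall s, 0 <= s <= 1 -> f s = g s) ->
  has_derive01 f t l -> has_derive01 g t l.
Proof.
move=> t01 fg fl e /fl[r r0 rP]; exists r => // s s01 ts.
by rewrite -!fg//; exact: rP.
Qed.

Lemma has_derive01_cst (c : R) t : has_derive01 (fun=> c) t 0.
Proof.
move=> e e0; exists 1 => // s _ _.
by rewrite subrr mul0r subrr normr0 mulr_ge0// ltW.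
Qed.

Lemma has_derive01_lin (a : R) f g t l m :
  has_derive01 f t l -> has_derive01 g t m ->
  has_derive01 (fun s => a * f s + g s) t (a * l + m).
Proof.
move=> /has_derive01_cvg fl /has_derive01_cvg gm; apply/has_derive01_cvg.
rewrite (_ : slope01 _ _ = fun s => a * slope01 f t s + slope01 g t s).
  by apply: cvgD => //; apply: cvgM => //; exact: cvg_cst.
by apply/funext => s; rewrite /slope01; ring.
Qed.

Lemma has_derive01_continuous f (f' : R -> R) :
  (forall t, 0 <= t <= 1 -> has_derive01 f t (f' t)) ->
  {within `[0, 1], continuous f}.
Proof.
move=> ff'; apply/continuous01P => t t01 e e0.
(* With error 1, the increment of [f] near [t] is at most [(|f' t| + 1) * |t - s|]. *)
have [r r0 rP] := ff' t t01 1 ltr01.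
have k0 : 0 < `|f' t| + 1 by rewrite ltr_wpDl.
exists (Num.min r (e / (`|f' t| + 1))); first by rewrite lt_min r0 divr_gt0.
move=> s s01; rewrite lt_min => /andP[/(rP s s01) h1].
rewrite ltr_pdivlMr// => h2.
apply: le_lt_trans h2.
rewrite (distrC (f t)) (distrC t) -[f s - f t](subrK (f' t * (s - t))).
rewrite (le_trans (ler_normD _ _))// [leRHS]mulrDr mulr1 [leRHS]addrC.
by rewrite mul1r in h1; rewrite lerD// normrM mulrC.
Qed.

Lemma has_derive01_is_derive f t l : 0 < t < 1 ->
  has_derive01 f t l -> is_derive t 1 f l.
Proof.
move=> /andP[t0 t1] fl.
have H : (fun h : R => h^-1 *: ((f \o shift t) (h *: 1) - f t)) @ 0^' --> l.
  rewrite (_ : (fun h => _) = fun h => (f (h + t) - f t) / h); last first.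
    by apply/funext => h; rewrite /= [h *: 1]mulr1 [LHS]mulrC.
  apply/cvgrPdist_le => e e0; have [r r0 rP] := fl e e0.
  rewrite near_withinE near_nbhs; apply/nbhs_ballP.
  (* The bounds [t] and [1 - t] keep [h + t] in [0,1]. *)
  exists (Num.min r (Num.min t (1 - t))).
    by rewrite /= !lt_min r0 t0 subr_gt0 t1.
  move=> h; rewrite /ball /= sub0r normrN !lt_min => /and3P[hr ht ht1] h0.
  have ht01 : 0 <= h + t <= 1.
    by move: ht ht1; rewrite !ltr_norml => /andP[? ?] /andP[? ?]; lra.
  have := rP (h + t) ht01; rewrite opprD addrCA subrr addr0 normrN => /(_ hr).
  rewrite addrK -ler_pdivrMr ?normr_gt0// -normf_div.
  by rewrite mulrBl mulfK// distrC.
by split; [apply/cvg_ex; exists l|exact: cvg_lim].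
Qed.

(** The classical theorem applies: inside, the derivatives are two-sided, and at the ends they give
    continuity. The bound on [|t - c|] later lets uniform continuity compare [f' c] with [f' t], for
    [s] on either side of [t]. *)
Lemma has_derive01_MVT f (f' : R -> R) t s :
  (forall t, 0 <= t <= 1 -> has_derive01 f t (f' t)) ->
  0 <= t <= 1 -> 0 <= s <= 1 ->
  exists c, [/\ 0 <= c <= 1, `|t - c| <= `|t - s| & f s - f t = f' c * (s - t)].
Proof.
move=> ff'; have main a b : 0 <= a -> a <= b -> b <= 1 ->
    exists2 c, a <= c <= b & f b - f a = f' c * (b - a).
  move=> a0 ab b1.
  have fi x : x \in `]a, b[ -> is_derive x 1 f (f' x).
    rewrite in_itv /= => /andP[ax xb].
    by apply: has_derive01_is_derive; [lra|apply: ff'; lra].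
  have [|c + E] := MVT_segment ab fi; last by rewrite in_itv; exists c.
  apply: continuous_subspaceW (has_derive01_continuous ff').
  by move=> x /=; rewrite !in_itv /=; lra.
move=> /andP[t0 t1] /andP[s0 s1].
have [ts|/ltW st] := leP t s.
  have [c /andP[tc cs] E] := main t s t0 ts s1.
  exists c; split=> //; first lra.
  by rewrite distrC (distrC t) !ger0_norm; lra.
have [c /andP[tc cs] E] := main s t s0 st t1.
exists c; split=> //; first lra.
  by rewrite !ger0_norm; lra.
by rewrite -[LHS]opprB E; ring.
Qed.

End UnitInterval.

(** * The primitive vanishing at 0 and the fundamental theorem of calculus *)

Section IntegralFromZero.
Variable R : realType.
Implicit Types (f g : R -> R) (t s x e : R).
Notation mu := (@lebesgue_measure R).

Definition int0 f x := \int[mu]_(t in `[0, x]) f t.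

Lemma continuous01_integrable f x : x <= 1 ->
  {within `[0, 1], continuous f} -> mu.-integrable `[0, x] (EFin \o f).
Proof.
move=> x1 cf; apply: continuous_compact_integrable;
  first exact: segment_compact.
by apply: continuous_subspaceW cf => y /=; rewrite !in_itv /=; lra.
Qed.

Lemma int0_ext f g x : x <= 1 ->
  (forall t, 0 <= t <= 1 -> f t = g t) -> int0 f x = int0 g x.
Proof.
move=> x1 fg; apply: eq_Rintegral => t; rewrite inE /= in_itv /= => tx.
by apply: fg; lra.
Qed.

Lemma continuous01_lin (a : R) f g :
  {within `[0, 1], continuous f} -> {within `[0, 1], continuous g} ->
  {within `[0, 1], continuous (fun t => a * f t + g t)}.
Proof.
move=> cf cg t.
by apply: cvgD; [apply: cvgM; [exact: cvg_cst|exact: cf]|exact: cg].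
Qed.

Lemma int0_lin (a : R) f g x : x <= 1 ->
  {within `[0, 1], continuous f} -> {within `[0, 1], continuous g} ->
  int0 (fun t => a * f t + g t) x = a * int0 f x + int0 g x.
Proof.
move=> x1 /(continuous01_integrable x1) fi /(continuous01_integrable x1) gi.
rewrite /int0 RintegralD ?RintegralZl//.
exact: (integrableZl _ a fi).
Qed.

Lemma int0_0 f : int0 f 0 = 0.
Proof. by rewrite /int0 set_itv1 Rintegral_set1. Qed.

Lemma int0_cst (c : R) x : 0 <= x -> int0 (fun=> c) x = c * x.
Proof.
move=> x0; rewrite /int0 Rintegral_cst//= lebesgue_measure_itv /= lte_fin.
case: ltP => /= h; first by rewrite subr0.
by congr (_ * _); lra.
Qed.

(** The common source of the later estimates: [c = f t] gives the derivative of the primitive,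
    [c = 0] gives bounds and Lipschitz continuity. *)
Lemma int0_increment f (c e t s : R) : {within `[0, 1], continuous f} ->
  0 <= t <= 1 -> 0 <= s <= 1 ->
  (forall r : R, 0 <= r <= 1 -> `|t - r| <= `|t - s| -> `|f r - c| <= e) ->
  `|int0 f s - int0 f t - c * (s - t)| <= e * `|s - t|.
Proof.
move=> cf; have main (a b : R) : 0 <= a -> a <= b -> b <= 1 ->
    (forall r : R, a <= r <= b -> `|f r - c| <= e) ->
    `|int0 f b - int0 f a - c * (b - a)| <= e * (b - a).
  move=> a0 ab b1 fe.
  have mab : fine (mu `]a, b]) = b - a.
    by rewrite lebesgue_measure_itv /= lte_fin; case: ltP => /= h; lra.
  have fi := continuous01_integrable b1 cf.
  rewrite /int0 Rintegral_itvB ?bnd_simp//.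
  have sub : `]a, b] `<=` `[0, b].
    by move=> y /=; rewrite !in_itv /=; lra.
  have fi' : mu.-integrable `]a, b] (EFin \o f) by exact: integrableS fi.
  have ci (k : R) : mu.-integrable `]a, b] (EFin \o fun=> k).
    apply: (@integrableS _ _ _ mu `[0, b] `]a, b] (EFin \o (fun=> k))
      _ _ sub _) => //.
    apply: continuous01_integrable => //.
    by apply: continuous_subspaceT; exact: cst_continuous.
  (* Reading [b - a] as the measure of []a, b]] turns both sides into integrals, to be compared
     pointwise. *)
  rewrite -mab -Rintegral_cst// -Rintegral_cst// -RintegralB//.
  have fci : mu.-integrable `]a, b] (EFin \o (fun r => f r - c)).
    exact: (integrableB _ fi' (ci c)).
  apply: le_trans (le_normr_Rintegral _ fci) _ => //.
  apply: le_Rintegral => //; first exact: integrable_norm.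
  by move=> y /=; rewrite in_itv /= => yab; apply: fe; lra.
move=> /andP[t0 t1] /andP[s0 s1] fe.
have [ts|/ltW st] := leP t s.
  rewrite [X in _ <= _ * X]ger0_norm ?subr_ge0//; apply: main => // r rts.
  by apply: fe; [lra|rewrite distrC (distrC t) !ger0_norm; lra].
rewrite distrC [X in _ <= _ * X]distrC [X in _ <= _ * X]ger0_norm ?subr_ge0//.
rewrite (_ : _ - _ = int0 f t - int0 f s - c * (t - s)); last by ring.
by apply: main => // r rts; apply: fe; [lra|rewrite !ger0_norm; lra].
Qed.

Lemma int0_bound f (e x : R) : {within `[0, 1], continuous f} -> 0 <= x <= 1 ->
  (forall r, 0 <= r <= 1 -> `|f r| <= e) -> `|int0 f x| <= e.
Proof.
move=> cf x01 fe.
have e0 : 0 <= e by apply: le_trans (normr_ge0 _) (fe 0 _); lra.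
have := @int0_increment f 0 e 0 x cf; rewrite int0_0 !subr0 mul0r subr0 => H.
have /le_trans : `|int0 f x| <= e * `|x|.
  by apply: H => [||r r01 _]; rewrite ?subr0; [lra|lra|exact: fe].
by apply; rewrite ger0_norm; last lra; rewrite ler_piMr//; lra.
Qed.

Lemma int0_FTC1 f t : {within `[0, 1], continuous f} -> 0 <= t <= 1 ->
  has_derive01 (int0 f) t (f t).
Proof.
move=> cf t01 e e0; have [r r0 rP] := (continuous01P f).1 cf t t01 e e0.
exists r => // s s01 ts; apply: int0_increment => // y y01 ty.
by rewrite distrC ltW// rP// (le_lt_trans ty).
Qed.

(** By [int0_FTC1] the function [f - int0 f'] has derivative zero, so the mean value theorem makes
    it constant. *)
Lemma int0_FTC2 f (f' : R -> R) x : {within `[0, 1], continuous f'} ->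
  (forall t, 0 <= t <= 1 -> has_derive01 f t (f' t)) ->
  0 <= x <= 1 -> int0 f' x = f x - f 0.
Proof.
move=> cf' ff' x01.
have H t : 0 <= t <= 1 ->
    has_derive01 (fun s => -1 * int0 f' s + f s) t (-1 * f' t + f' t).
  by move=> t01; apply: has_derive01_lin; [exact: int0_FTC1|exact: ff'].
have [||c [_ _ /=]] := has_derive01_MVT (t := 0) (s := x) H => //; first lra.
by rewrite int0_0 => E; lra.
Qed.

End IntegralFromZero.

(** * Smooth functions on the cube; mean, primitive and [A_i] in one variable *)

Section Cube.
Variables (R : realType) (d : nat).
Implicit Types (x y : 'rV[R]_d) (u v : 'rV[R]_d -> R) (i j k : 'I_d)
  (s t e : R).

Lemma upd_eq x i t : upd x i t 0 i = t.
Proof. by rewrite mxE eqxx. Qed.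

Lemma upd_neq x i k t : k != i -> upd x i t 0 k = x 0 k.
Proof. by rewrite mxE => /negPf ->. Qed.

Lemma upd_upd x i s t : upd (upd x i s) i t = upd x i t.
Proof. by apply/rowP => k; rewrite !mxE; case: (k == i). Qed.

Lemma upd_comm x i j s t : i != j ->
  upd (upd x i s) j t = upd (upd x j t) i s.
Proof.
move=> ij; apply/rowP => k; rewrite !mxE.
by case: (eqVneq k j) => // ->; rewrite eq_sym (negPf ij).
Qed.

Lemma upd_id x i : upd x i (x 0 i) = x.
Proof. by apply/rowP => k; rewrite mxE; case: eqP => // ->. Qed.

Lemma cube_upd x i t : cube x -> 0 <= t <= 1 -> cube (upd x i t).
Proof. by move=> cx t01 k; rewrite mxE; case: ifP. Qed.

Lemma ball_rowP x y e : 0 < e ->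
  ball x e y <-> forall k, `|x 0 k - y 0 k| < e.
Proof.
move=> e0; split=> [[_ xy] k|xy]; first exact: xy.
by split=> // i k; rewrite (ord1 i); exact: xy.
Qed.

Lemma ball_upd x y e i t : 0 < e -> ball x e y ->
  ball (upd x i t) e (upd y i t).
Proof.
move=> e0 /(ball_rowP _ _ e0) xy; apply/(ball_rowP _ _ e0) => k; rewrite !mxE.
by case: ifP => // _; rewrite subrr normr0.
Qed.

Lemma ball_upd_line x e i s t : 0 < e -> `|s - t| < e ->
  ball (upd x i s) e (upd x i t).
Proof.
move=> e0 st; apply/(ball_rowP _ _ e0) => k; rewrite !mxE.
by case: ifP => // _; rewrite subrr normr0.
Qed.

Lemma cube_compact : compact (@cube R d).
Proof.
exact: (@rV_compact R d (fun=> `[0, 1]%classic) (fun=> @segment_compact R 0 1)).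
Qed.

(** Integration along whole lines requires one radius for all points of the cube; compactness
    provides it. *)
Definition ucont u := forall e, 0 < e -> exists2 r, 0 < r &
  forall x y, cube x -> cube y -> ball x r y -> `|u x - u y| < e.

Lemma ucontP u : ucont u <-> {within @cube R d, continuous u}.
Proof.
rewrite subspace_continuousP; split=> [cu x cx|cu e e0].
  apply/cvgrPdist_lt => e e0; have [r r0 rP] := cu e e0.
  rewrite near_withinE near_nbhs; apply/nbhs_ballP.
  by exists r => //= y xy cy; exact: rP.
have /compact_near_coveringP/near_covering_withinP cov := cube_compact.
have e20 : 0 < e / 2 by rewrite divr_gt0.
have := cov R 0^'+ (fun r x =>
  forall y, cube y -> ball x r y -> `|u x - u y| < e).
have H x : cube x -> \forall x' \near x & r \near 0^'+,
    cube x' -> forall y, cube y -> ball x' r y -> `|u x' - u y| < e.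
  move=> cx; have /cvgrPdist_lt/(_ _ e20) := cu x cx.
  rewrite near_withinE near_nbhs => /nbhs_ballP[r /= r0 rP].
  (* Half the local radius: points within [s < r / 2] of [x'] are still within [r] of [x]. *)
  exists (ball x (r / 2), [set s | s < r / 2]).
    split => /=; first by apply: nbhsx_ballx; rewrite divr_gt0.
    by apply: nbhs_right_lt; rewrite divr_gt0.
  move=> [x' s] /= [xx' sr] cx' y cy x'y.
  have h1 : `|u x - u x'| < e / 2.
    by apply: rP => //; apply: le_ball xx'; lra.
  have h2 : `|u x - u y| < e / 2.
    by apply: rP => //; apply: ball_split xx' (le_ball _ x'y); exact: ltW.
  rewrite -(subrK (u x) (u x')) -addrA (le_lt_trans (ler_normD _ _))//.
  by rewrite distrC; lra.
move=> /(_ _ H) => near0.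
have [|r [r0 rP]] := @filter_ex _ 0^'+ _
    (fun r => 0 < r /\ (@cube R d `<=`
      (fun x => forall y, cube y -> ball x r y -> `|u x - u y| < e))).
  by apply: filterI; [exact: nbhs_right_gt|exact: near0].
by exists r => // x y cx; exact: rP.
Qed.

Lemma ucont_bounded u : ucont u -> exists2 M, 0 < M &
  forall x, cube x -> `|u x| <= M.
Proof.
move=> /ucontP cu.
have /compact_bounded[M [_ /(_ (`|M| + 1))]] :=
  continuous_compact cu cube_compact.
rewrite (le_lt_trans (ler_norm M)) ?ltrDl// => /(_ isT) MP.
exists (`|M| + 1); first by rewrite ltr_wpDl.
by move=> x cx; apply: MP; exists x.
Qed.

Lemma ucont_line u x i : ucont u -> cube x ->
  {within `[0, 1], continuous (fun t => u (upd x i t))}.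
Proof.
move=> cu cx; apply/continuous01P => t t01 e /cu[r r0 rP].
exists r => // s s01 ts; apply: rP; [exact: cube_upd..|exact: ball_upd_line].
Qed.

Lemma ucont_lin (a : R) u v : ucont u -> ucont v ->
  ucont (fun x => a * u x + v x).
Proof.
move=> /ucontP cu /ucontP cv; apply/ucontP => x.
by apply: cvgD; [apply: cvgM; [exact: cvg_cst|exact: cu]|exact: cv].
Qed.

Definition has_partial j u x l :=
  has_derive01 (fun t => u (upd x j t)) (x 0 j) l.

Lemma has_partial_partial j u x l : cube x -> has_partial j u x l ->
  partial j u x = l.
Proof. by move=> cx; apply: has_derive01_derive01. Qed.

Lemma smooth_ucont u : smooth u -> ucont u.
Proof. by move=> /(_ [::])[] /= /ucontP. Qed.

Lemma smooth_has_partial u j x : smooth u -> cube x ->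
  has_partial j u x (partial j u x).
Proof.
by move=> /(_ [::])[_ du] cx; apply: derivable01_has_derive; exact: du.
Qed.

(** [foldr] applies the last entry of the list first, so [s] for [partial j u] is [rcons s j] for
    [u]. *)
Lemma smooth_partial u j : smooth u -> smooth (partial j u).
Proof. by move=> su s; have := su (rcons s j); rewrite foldr_rcons. Qed.

(** By induction on the list, each iterated partial derivative agrees on the cube with a member of
    [K]. This coinduction principle reduces smoothness of a construction to its first
    derivatives. *)
Lemma smooth_coind (K : ('rV[R]_d -> R) -> Prop) :
  (forall u, K u -> ucont u /\ forall j, exists2 v, K v &
     forall x, cube x -> has_partial j u x (v x)) ->
  forall u, K u -> smooth u.
Proof.
move=> HK u Ku s.
have [v Kv uv] : exists2 v, K v &
    forall x, cube x -> foldr (@partial R d) u s x = v x.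
  elim: s => [|j s [v Kv uv]] /=; first by exists u.
  have [_ /(_ j)[w Kw vw]] := HK v Kv; exists w => // x cx.
  apply: has_partial_partial => //.
  apply: has_derive01_ext (vw x cx) => //.
  by move=> t t01; rewrite uv//; exact: cube_upd.
have [cv dv] := HK v Kv; split=> [|j x cx].
  apply/ucontP => e /cv[r r0 rP]; exists r => // x y cx cy xy.
  by rewrite !uv//; exact: rP.
have [w _ vw] := dv j; apply: has_derive01_derivable.
apply: has_derive01_ext (vw x cx) => // t t01.
by rewrite uv//; exact: cube_upd.
Qed.

Lemma smooth_ext u v : (forall x, cube x -> u x = v x) -> smooth u -> smooth v.
Proof.
move=> uv su.
apply: (@smooth_coind (fun v =>
  exists2 u, smooth u & forall x, cube x -> u x = v x)); last by exists u.
move=> {su uv v}v {u}[u su uv]; split.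
  move=> e /(smooth_ucont su)[r r0 rP]; exists r => // x y cx cy xy.
  by rewrite -!uv//; exact: rP.
move=> j; exists (partial j u).
  by exists (partial j u) => //; exact: smooth_partial.
move=> x cx; apply: has_derive01_ext (smooth_has_partial j su cx) => // t t01.
by rewrite uv//; exact: cube_upd.
Qed.

Lemma smooth_cst (c : R) : smooth (fun _ : 'rV[R]_d => c).
Proof.
apply: (@smooth_coind (fun u => exists c, u = fun=> c)); last by exists c.
move=> _ [{}c ->]; split=> [e e0|j].
  by exists 1 => // x y _ _ _; rewrite subrr normr0.
by exists (fun=> 0); [exists 0|move=> x cx; exact: has_derive01_cst].
Qed.

Lemma has_partial_lin (a : R) u v j x l m :
  has_partial j u x l -> has_partial j v x m ->
  has_partial j (fun x => a * u x + v x) x (a * l + m).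
Proof. exact: has_derive01_lin. Qed.

Lemma smooth_lin (a : R) u v : smooth u -> smooth v ->
  smooth (fun x => a * u x + v x).
Proof.
move=> su sv; apply: (@smooth_coind (fun w => exists u v,
  [/\ smooth u, smooth v & w = fun x => a * u x + v x])); last by exists u, v.
move=> _ [{su}u [{sv}v [su sv ->]]]; split.
  by apply: ucont_lin; exact: smooth_ucont.
move=> j; exists (fun x => a * partial j u x + partial j v x).
  by exists (partial j u), (partial j v); split=> //; exact: smooth_partial.
by move=> x cx; apply: has_partial_lin; exact: smooth_has_partial.
Qed.

Definition prim_i i u x := int0 (fun t => u (upd x i t)) (x 0 i).

Lemma mean_iE i u x : mean_i i u x = int0 (fun t => u (upd x i t)) 1.
Proof. by []. Qed.

(** The shape [-1 * _ + _] fits the combinations [a * u + v] of the linearity lemmas. *)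
Lemma Aop_iE i u x : Aop_i i u x = -1 * mean_i i (prim_i i u) x + prim_i i u x.
Proof.
have E : \int[lebesgue_measure]_(y in `[0, 1])
    (\int[lebesgue_measure]_(t in `[0, y]) u (upd x i t)) =
    mean_i i (prim_i i u) x.
  apply: eq_Rintegral => t _; rewrite /prim_i upd_eq /int0.
  by apply: eq_Rintegral => s _; rewrite upd_upd.
by rewrite mulN1r addrC -E.
Qed.

Lemma Aop_i_funE i u :
  Aop_i i u = fun x => -1 * mean_i i (prim_i i u) x + prim_i i u x.
Proof. by apply/funext => x; exact: Aop_iE. Qed.

Lemma int0_line_dist u i x y e s : ucont u -> cube x -> cube y ->
  0 <= s <= 1 ->
  (forall t, 0 <= t <= 1 -> `|u (upd x i t) - u (upd y i t)| <= e) ->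
  `|int0 (fun t => u (upd x i t)) s - int0 (fun t => u (upd y i t)) s| <= e.
Proof.
move=> cu cx cy s01 xye; rewrite addrC -[X in _ + X]mul1r -mulN1r.
have lx := ucont_line (i := i) cu cx; have ly := ucont_line (i := i) cu cy.
rewrite mul1r -int0_lin//; last by case/andP: s01.
apply: int0_bound => //; last by move=> t t01; rewrite mulN1r addrC xye.
exact: continuous01_lin.
Qed.

Lemma mean_ucont i u : ucont u -> ucont (mean_i i u).
Proof.
move=> cu e e0; have [r r0 rP] := cu (e / 2) (divr_gt0 e0 (ltr0n _ 2)).
exists r => // x y cx cy xy.
apply: (@le_lt_trans _ _ (e / 2)); last lra.
apply: int0_line_dist => // [|t t01]; first by rewrite ler01 lexx.
by apply/ltW/rP; [exact: cube_upd..|exact: ball_upd].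
Qed.

(** Moving the line is controlled by uniform continuity of [u], moving the upper limit by a bound
    [M] of [|u|]; hence the radius [e / 2 / M]. *)
Lemma prim_ucont i u : ucont u -> ucont (prim_i i u).
Proof.
move=> cu e e0; have [r r0 rP] := cu (e / 2) (divr_gt0 e0 (ltr0n _ 2)).
have [M M0 MP] := ucont_bounded cu.
exists (Num.min r (e / 2 / M)); first by rewrite lt_min r0 !divr_gt0.
move=> x y cx cy xy.
have xyr : ball x r y by apply: le_ball xy; rewrite ge_min lexx.
have h1 : `|prim_i i u x - int0 (fun t => u (upd y i t)) (x 0 i)| <= e / 2.
  apply: int0_line_dist => // t t01.
  by apply/ltW/rP; [exact: cube_upd..|exact: ball_upd].
have h2 : `|prim_i i u y - int0 (fun t => u (upd y i t)) (x 0 i)| < e / 2.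
  have := @int0_increment _ (fun t => u (upd y i t)) 0 M (x 0 i) (y 0 i).
  rewrite mul0r subr0 => /(_ (ucont_line (i := i) cu cy) (cx i) (cy i)) H.
  apply: le_lt_trans (H _) _.
    by move=> t t01 _; rewrite subr0 MP//; exact: cube_upd.
  move: xy => [_ /(_ 0 i)]; rewrite /ball /=; rewrite lt_min => /andP[_].
  by rewrite ltr_pdivlMr// mulrC distrC.
set c := int0 _ _ in h1 h2.
rewrite -(subrK c (prim_i i u x)) -addrA (le_lt_trans (ler_normD _ _))//.
by rewrite (distrC c); lra.
Qed.

(* By the mean value theorem the difference quotients in [x_j] converge
   uniformly in [x_i]. *)
Lemma has_derive01_int0 i j u v x s : i != j -> ucont u -> ucont v ->
  (forall x, cube x -> has_partial j u x (v x)) -> cube x -> 0 <= s <= 1 ->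
  has_derive01 (fun t => int0 (fun r => u (upd (upd x j t) i r)) s) (x 0 j)
    (int0 (fun r => v (upd x i r)) s).
Proof.
move=> ij cu cv uv cx s01 e e0; have [r r0 rP] := cv e e0.
exists r => // t t01 xt.
have cxt := cube_upd j cx t01.
have lu := ucont_line (i := i) cu cx; have lut := ucont_line (i := i) cu cxt.
have lv := ucont_line (i := i) cv cx.
have s1 : s <= 1 by case/andP: s01.
(* Written as one integral, the first-order remainder needs only a pointwise bound on the
   integrand. *)
rewrite upd_id (_ : _ - _ = int0 (fun r => - (t - x 0 j) * v (upd x i r) +
  (-1 * u (upd x i r) + u (upd (upd x j t) i r))) s); last first.
  by rewrite !int0_lin//; [ring|exact: continuous01_lin].
apply: int0_bound => //;
  first by apply: continuous01_lin => //; exact: continuous01_lin.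
move=> y y01; have cxy := cube_upd i cx y01.
have D z : 0 <= z <= 1 -> has_derive01 (fun t => u (upd (upd x i y) j t)) z
    (v (upd (upd x i y) j z)).
  move=> z01; have := uv _ (cube_upd j cxy z01).
  rewrite /has_partial upd_eq; apply: has_derive01_ext => // t' _.
  by rewrite upd_upd.
(* The point [c] depends on [y], but its distance to [x 0 j] is below [r], which does not. *)
have [c [c01 xc E]] := has_derive01_MVT D (cx j) t01.
have -> : - (t - x 0 j) * v (upd x i y) +
    (-1 * u (upd x i y) + u (upd (upd x j t) i y)) =
    (v (upd (upd x i y) j c) - v (upd x i y)) * (t - x 0 j).
  rewrite mulrBl -E [upd (upd x j t) i y]upd_comm 1?eq_sym//.
  by rewrite [upd (upd x i y) j (x 0 j)]upd_comm// upd_id; ring.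
rewrite normrM ler_wpM2r// ltW// rP//; first exact: cube_upd.
apply/(ball_rowP _ _ r0) => k; rewrite !mxE.
have [->|kj] := eqVneq k j; last by rewrite subrr normr0.
by rewrite [j == i]eq_sym (negPf ij) distrC (le_lt_trans xc).
Qed.

Lemma mean_ext i u v x : (forall x, cube x -> u x = v x) -> cube x ->
  mean_i i u x = mean_i i v x.
Proof.
by move=> uv cx; apply: int0_ext => // t t01; rewrite uv//; exact: cube_upd.
Qed.

Lemma has_partial_mean_same i u x : cube x -> has_partial i (mean_i i u) x 0.
Proof.
move=> cx; apply: has_derive01_ext (has_derive01_cst (mean_i i u x) _) => //.
by move=> s _; rewrite !mean_iE; apply: int0_ext => // t _; rewrite upd_upd.
Qed.

Lemma has_partial_prim_same i u x : smooth u -> cube x ->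
  has_partial i (prim_i i u) x (u x).
Proof.
move=> /smooth_ucont su cx.
have := int0_FTC1 (ucont_line (i := i) su cx) (cx i); rewrite upd_id.
apply: has_derive01_ext => // s s01; rewrite /prim_i upd_eq.
by apply: int0_ext => [|t _]; [case/andP: s01|rewrite upd_upd].
Qed.

Lemma has_partial_mean i j u x : j != i -> smooth u -> cube x ->
  has_partial j (mean_i i u) x (mean_i i (partial j u) x).
Proof.
move=> ij su cx; apply: has_derive01_int0 => //.
- by rewrite eq_sym.
- exact: smooth_ucont.
- exact/smooth_ucont/smooth_partial.
- by move=> y cy; exact: smooth_has_partial.
- by rewrite ler01 lexx.
Qed.

Lemma has_partial_prim i j u x : j != i -> smooth u -> cube x ->
  has_partial j (prim_i i u) x (prim_i i (partial j u) x).
Proof.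
move=> ji su cx.
have ij : i != j by rewrite eq_sym.
have uv y : cube y -> has_partial j u y (partial j u y).
  by move=> cy; exact: smooth_has_partial.
have := has_derive01_int0 ij (smooth_ucont su)
  (smooth_ucont (smooth_partial j su)) uv cx (cx i).
apply: has_derive01_ext => [|s _]; first exact: cx.
by rewrite /prim_i upd_neq.
Qed.

Lemma smooth_mean i u : smooth u -> smooth (mean_i i u).
Proof.
(* The zero function serves as the derivative of the mean in direction [i]. *)
move=> su; apply: (@smooth_coind (fun w =>
  (exists2 u, smooth u & w = mean_i i u) \/ w = fun=> 0));
  last by left; exists u.
move=> _ [[{su}u su ->]|->]; last first.
  split; first exact/smooth_ucont/smooth_cst.
  by move=> j; exists (fun=> 0); [right|move=> x cx; exact: has_derive01_cst].
split; first exact/mean_ucont/smooth_ucont.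
move=> j; have [->|ij] := eqVneq j i.
  exists (fun=> 0); [by right|move=> x cx; exact: has_partial_mean_same].
exists (mean_i i (partial j u)).
  by left; exists (partial j u) => //; exact: smooth_partial.
by move=> x cx; exact: has_partial_mean.
Qed.

Lemma smooth_prim i u : smooth u -> smooth (prim_i i u).
Proof.
(* The class contains all smooth functions because the derivative in direction [i] is [u] itself. *)
move=> su; apply: (@smooth_coind (fun w =>
  (exists2 u, smooth u & w = prim_i i u) \/ smooth w)); last by left; exists u.
move=> w [[{su}u su ->]|{su}su]; last first.
  split; first exact: smooth_ucont.
  move=> j; exists (partial j w); first by right; exact: smooth_partial.
  by move=> x cx; exact: smooth_has_partial.
split; first exact/prim_ucont/smooth_ucont.
move=> j; have [->|ij] := eqVneq j i.
  by exists u; [right|move=> x cx; exact: has_partial_prim_same].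
exists (prim_i i (partial j u)).
  by left; exists (partial j u) => //; exact: smooth_partial.
by move=> x cx; exact: has_partial_prim.
Qed.

Lemma smooth_Aop i u : smooth u -> smooth (Aop_i i u).
Proof.
move=> su; rewrite Aop_i_funE.
by apply: smooth_lin; [apply: smooth_mean|]; exact: smooth_prim.
Qed.

Lemma has_partial_Aop_same i u x : smooth u -> cube x ->
  has_partial i (Aop_i i u) x (u x).
Proof.
move=> su cx; rewrite Aop_i_funE.
rewrite -[u x]add0r -(mulr0 (-1)); apply: has_partial_lin.
  exact: has_partial_mean_same.
exact: has_partial_prim_same.
Qed.

Lemma has_partial_Aop i j u x : j != i -> smooth u -> cube x ->
  has_partial j (Aop_i i u) x (Aop_i i (partial j u) x).
Proof.
move=> ij su cx; rewrite Aop_i_funE.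
rewrite Aop_iE; apply: has_partial_lin; last exact: has_partial_prim.
rewrite (@mean_ext i (prim_i i (partial j u)) (partial j (prim_i i u)) x) //.
  by apply: has_partial_mean => //; exact: smooth_prim.
by move=> y cy; apply/esym/has_partial_partial => //; exact: has_partial_prim.
Qed.

(** The primitive of [partial i u] is [u] minus its value at [x_i = 0]; that value is constant in
    [x_i] and cancels when the mean is subtracted. *)
Lemma Aop_partial i u x : smooth u -> cube x ->
  Aop_i i (partial i u) x = u x - mean_i i u x.
Proof.
move=> su cx.
have E y : cube y -> prim_i i (partial i u) y = u y - u (upd y i 0).
  move=> cy; rewrite /prim_i.
  rewrite (int0_FTC2 (f := fun t => u (upd y i t))) ?upd_id//.
    exact/ucont_line/cy/smooth_ucont/smooth_partial.
  move=> t t01; have := smooth_has_partial i su (cube_upd i cy t01).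
  rewrite /has_partial upd_eq; apply: has_derive01_ext => // s _.
  by rewrite upd_upd.
rewrite Aop_iE E// (mean_ext i E)// !mean_iE.
rewrite (@int0_ext _ _ (fun t => -1 * u (upd x i 0) + u (upd x i t))) //;
  last first.
  by move=> t t01; rewrite upd_upd; ring.
rewrite int0_lin// ?int0_cst//; first ring.
  by apply: continuous_subspaceT; exact: cst_continuous.
exact/ucont_line/cx/smooth_ucont.
Qed.

Lemma mean_lin (a : R) i u v x : smooth u -> smooth v -> cube x ->
  mean_i i (fun y => a * u y + v y) x = a * mean_i i u x + mean_i i v x.
Proof.
move=> su sv cx; rewrite !mean_iE int0_lin//;
  exact/ucont_line/cx/smooth_ucont.
Qed.

Lemma prim_lin (a : R) i u v x : smooth u -> smooth v -> cube x ->
  prim_i i (fun y => a * u y + v y) x = a * prim_i i u x + prim_i i v x.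
Proof.
move=> su sv cx; rewrite /prim_i int0_lin//;
  [by case/andP: (cx i)|exact/ucont_line/cx/smooth_ucont..].
Qed.

Lemma Aop_lin (a : R) i u v x : smooth u -> smooth v -> cube x ->
  Aop_i i (fun y => a * u y + v y) x = a * Aop_i i u x + Aop_i i v x.
Proof.
move=> su sv cx; rewrite !Aop_iE prim_lin//.
rewrite (@mean_ext i _ (fun y => a * prim_i i u y + prim_i i v y)) //;
  last first.
  by move=> y cy; exact: prim_lin.
by rewrite mean_lin; [ring|exact: smooth_prim..|].
Qed.

Lemma partial_lin (a : R) j u v x : smooth u -> smooth v -> cube x ->
  partial j (fun y => a * u y + v y) x = a * partial j u x + partial j v x.
Proof.
move=> su sv cx; apply: has_partial_partial => //.
by apply: has_partial_lin; exact: smooth_has_partial.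
Qed.

End Cube.

(** * Signs from reordering wedge products *)

Section Signs.
Variable d : nat.
Implicit Types (i j : 'I_d) (J : {set 'I_d}).

Lemma nbeforeU1 i j J : i \notin J ->
  nbefore j (i |: J)%SET = ((i < j) + nbefore j J)%N.
Proof.
move=> iJ; rewrite /nbefore; case: ltnP => ij.
  rewrite (_ : [set k in _ | _] = i |: [set k in J | (k < j)%N])%SET.
    by rewrite cardsU1 !inE (negPf iJ).
  by apply/setP => k; rewrite !inE; case: eqVneq => // ->; rewrite ij.
congr #|pred_of_set _|; apply/setP => k; rewrite !inE.
by case: eqVneq => // ->; rewrite (negPf iJ) ltnNge ij.
Qed.

Lemma nbefore_setU1 i J : i \notin J -> nbefore i (i |: J)%SET = nbefore i J.
Proof. by move=> iJ; rewrite nbeforeU1// ltnn. Qed.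

Lemma nbefore_setD1 i J : i \in J -> nbefore i (J :\ i)%SET = nbefore i J.
Proof.
by move=> iJ; rewrite -{2}(finset.setD1K iJ) nbefore_setU1// !inE eqxx.
Qed.

(** Removing [j] changes the count for [i] exactly if [j < i], adding [i] changes the count for [j]
    exactly if [i < j]; as [i != j], exactly one happens. The two products are the signs of the [j]
    terms in [d h_i] and [h_i d]. *)
Lemma sign_anticommute (R : comNzRingType) i j J : i \notin J -> j \in J ->
  (-1) ^+ nbefore j J * (-1) ^+ nbefore i (J :\ j)%SET =
  - ((-1) ^+ nbefore i J * (-1) ^+ nbefore j (i |: J)%SET) :> R.
Proof.
move=> iJ jJ; have ij : i != j by apply: contraNneq iJ => ->.
have -> : nbefore i J = ((j < i) + nbefore i (J :\ j)%SET)%N.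
  by rewrite -nbeforeU1 ?inE ?eqxx// finset.setD1K.
rewrite nbeforeU1// !exprD.
by case: ltngtP => [_|_|/val_inj E]; [ring|ring|rewrite E eqxx in ij].
Qed.

End Signs.

(** * The operators on forms, coefficient by coefficient *)

Section FormOperators.
Variables (R : realType) (d : nat).
Implicit Types (w eta : diff_form R d) (i j k : 'I_d) (J I : {set 'I_d})
  (x : 'rV[R]_d).

Lemma p_opE i w J : p_op i w J = if i \in J then 0 else mean_i i (w J).
Proof.
rewrite /p_op fct_sumE; case: ifPn => iJ.
  apply: big1 => I iI; rewrite /monoform; case: eqP => // E.
  by rewrite -E iJ in iI.
rewrite (bigD1 J)//= /monoform eqxx big1 ?addr0// => I /andP[_].
by rewrite eq_sym => /negPf ->.
Qed.

Lemma h_opE i w J : h_op i w J = if i \in J then 0 else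
  fun x => (-1) ^+ nbefore i J * Aop_i i (w (i |: J)%SET) x.
Proof.
rewrite /h_op fct_sumE; case: ifPn => iJ.
  apply: big1 => I _; rewrite /monoform; case: eqP => // E.
  by rewrite E !inE eqxx in iJ.
rewrite (bigD1 (i |: J)%SET) ?inE ?eqxx//= /monoform finset.setU1K// eqxx.
rewrite nbefore_setU1// big1 ?addr0// => I /andP[iI nI].
by case: eqP => // E; rewrite E finset.setD1K ?eqxx in nI.
Qed.

Lemma diff_form_sumE (T : Type) (r : seq T) (P : pred T)
    (F : T -> diff_form R d) J x :
  (\sum_(q <- r | P q) F q) J x = \sum_(q <- r | P q) F q J x.
Proof. by rewrite !fct_sumE. Qed.

(** For given [j], the only source set whose term lands on [dx_J] is [J :\ j]. *)
Lemma ext_dE w J x :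
  ext_d w J x =
  \sum_(j in J) (-1) ^+ nbefore j J * partial j (w (J :\ j)%SET) x.
Proof.
rewrite /ext_d (exchange_big_dep xpredT)//= diff_form_sumE [RHS]big_mkcond.
apply: eq_bigr => j _; rewrite diff_form_sumE; case: ifPn => jJ.
  rewrite (bigD1 (J :\ j)%SET) ?inE ?eqxx//=.
  rewrite /wedge_dx !inE eqxx /= /monoform finset.setD1K// eqxx nbefore_setD1//.
  rewrite big1 ?addr0// => I /andP[jI /negPf nI]; rewrite (negPf jI).
  by case: eqP => // E; rewrite E finset.setU1K ?eqxx in nI.
apply: big1 => I jI; rewrite /wedge_dx (negPf jI) /monoform.
by case: eqP => // E; rewrite E !inE eqxx in jJ.
Qed.

(** Integrals and limits are additive only where they exist, hence the smooth arguments. Zero,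
    multiples and sums all follow from this one combination. *)
Definition linear_on_smooth (T : ('rV[R]_d -> R) -> 'rV[R]_d -> R) :=
  forall (a : R) u v x, smooth u -> smooth v -> cube x ->
    T (fun y => a * u y + v y) x = a * T u x + T v x.

Lemma linear_on_smooth0 T x : linear_on_smooth T -> cube x -> T (fun=> 0) x = 0.
Proof.
move=> lT cx; have s0 := @smooth_cst R d 0.
(* With [a = -1] and both arguments zero, the right side is [- T 0 + T 0]. *)
have := lT (-1) _ _ x s0 s0 cx.
by under eq_fun do rewrite mulr0 addr0; rewrite mulN1r addNr.
Qed.

Lemma linear_on_smoothZ T (a : R) u x : linear_on_smooth T -> smooth u ->
  cube x -> T (fun y => a * u y) x = a * T u x.
Proof.
move=> lT su cx; have := lT a u _ x su (@smooth_cst R d 0) cx.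
by under eq_fun do rewrite addr0; rewrite linear_on_smooth0// addr0.
Qed.

Lemma smoothZ (a : R) (u : 'rV[R]_d -> R) :
  smooth u -> smooth (fun x => a * u x).
Proof.
move=> su; apply: smooth_ext (smooth_lin a su (@smooth_cst R d 0)) => x _.
by rewrite addr0.
Qed.

Lemma smooth_sum (T : Type) (r : seq T) (P : pred T)
    (F : T -> 'rV[R]_d -> R) : (forall q, P q -> smooth (F q)) ->
  smooth (fun x => \sum_(q <- r | P q) F q x).
Proof.
move=> sF; elim: r => [|q r IH].
  by apply: smooth_ext (@smooth_cst R d 0) => x _; rewrite big_nil.
have [Pq|/negPf Pq] := boolP (P q).
  apply: smooth_ext (smooth_lin 1 (sF q Pq) IH) => x _.
  by rewrite big_cons Pq mul1r.
by apply: smooth_ext IH => x _; rewrite big_cons Pq.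
Qed.

Lemma linear_on_smooth_sum L (T : Type) (r : seq T) (P : pred T)
    (F : T -> 'rV[R]_d -> R) x : linear_on_smooth L ->
  (forall q, P q -> smooth (F q)) -> cube x ->
  L (fun y => \sum_(q <- r | P q) F q y) x = \sum_(q <- r | P q) L (F q) x.
Proof.
move=> lL sF cx; elim: r => [|q r IH].
  rewrite big_nil (_ : (fun y => _) = fun=> 0) ?linear_on_smooth0//.
  by apply/funext => y; rewrite big_nil.
rewrite big_cons -IH; case: ifPn => Pq.
  rewrite -[L (F q) x]mul1r -lL//; [|exact: sF|exact: smooth_sum].
  by congr (L _ _); apply/funext => y; rewrite big_cons Pq mul1r.
by congr (L _ _); apply/funext => y; rewrite big_cons (negPf Pq).
Qed.

Lemma partial_linear j : linear_on_smooth (partial j).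
Proof. by move=> a u v x; exact: partial_lin. Qed.

Lemma Aop_linear i : linear_on_smooth (Aop_i i).
Proof. by move=> a u v x; exact: Aop_lin. Qed.

Lemma mean_linear i : linear_on_smooth (mean_i i).
Proof. by move=> a u v x; exact: mean_lin. Qed.

(** The degree is dropped: the identities hold coefficientwise in mixed degree, while [d] and [h_i]
    shift it. *)
Definition smooth_coefs w := forall J, smooth (w J).

Lemma smooth_p_op i w : smooth_coefs w -> smooth_coefs (p_op i w).
Proof.
move=> sw J; rewrite p_opE; case: ifP => _; first exact: smooth_cst.
exact: smooth_mean.
Qed.

Lemma smooth_h_op i w : smooth_coefs w -> smooth_coefs (h_op i w).
Proof.
move=> sw J; rewrite h_opE; case: ifP => _; first exact: smooth_cst.
exact/smoothZ/smooth_Aop.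
Qed.

Lemma ext_d_funE w J : ext_d w J = fun x =>
  \sum_(j in J) (-1) ^+ nbefore j J * partial j (w (J :\ j)%SET) x.
Proof. by apply/funext => x; exact: ext_dE. Qed.

Lemma smooth_ext_d w : smooth_coefs w -> smooth_coefs (ext_d w).
Proof.
move=> sw J; rewrite ext_d_funE; apply: smooth_sum => j _.
exact/smoothZ/smooth_partial.
Qed.

(** If [k] is not in [J], this is differentiation under the integral. If it is, only [j = k] could
    contribute to the left side, and the mean in [x_k] is constant in [x_k]. *)
Lemma p_op_ext_d k w : smooth_coefs w ->
  eq_form (ext_d (p_op k w)) (p_op k (ext_d w)).
Proof.
move=> sw J x cx; rewrite ext_dE p_opE; case: ifPn => kJ; last first.
  rewrite ext_d_funE (linear_on_smooth_sum _ (mean_linear k))//; last first.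
    by move=> j _; exact/smoothZ/smooth_partial.
  apply: eq_bigr => j jJ.
  rewrite (linear_on_smoothZ _ (mean_linear k))//; last first.
    exact: smooth_partial.
  rewrite p_opE !inE (negPf kJ) andbF; congr (_ * _).
  apply: has_partial_partial => //; apply: has_partial_mean => //.
  by apply: contraNneq kJ => <-.
apply: big1 => j jJ; rewrite p_opE !inE kJ andbT.
case: eqVneq => [->|_] /=; last first.
  by rewrite (linear_on_smooth0 (partial_linear j))// mulr0.
by rewrite (has_partial_partial cx (has_partial_mean_same _ _ cx)) mulr0.
Qed.

Lemma homotopy_h_op i w : smooth_coefs w ->
  eq_form (fun J x => ext_d (h_op i w) J x + h_op i (ext_d w) J x)
    (fun J x => w J x - p_op i w J x).
Proof.
move=> sw J x cx; rewrite ext_dE p_opE [h_op i (ext_d w) J]h_opE.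
case: ifPn => iJ.
  rewrite (bigD1 i)//= big1 ?addr0 ?subr0 => [|j /andP[jJ ji]]; last first.
    rewrite h_opE !inE eq_sym ji iJ /=.
    by rewrite (linear_on_smooth0 (partial_linear j))// mulr0.
  rewrite h_opE !inE eqxx /= finset.setD1K//.
  rewrite (linear_on_smoothZ _ (partial_linear i))//; last exact: smooth_Aop.
  rewrite (has_partial_partial cx (has_partial_Aop_same i (sw J) cx)).
  by rewrite nbefore_setD1// mulrA -expr2 sqrr_sign mul1r ?addr0 ?subr0.
rewrite ext_d_funE (linear_on_smooth_sum _ (Aop_linear i))//; last first.
  by move=> j _; exact/smoothZ/smooth_partial.
(* The term [j = i] of [ext_d w] at [i |: J] yields [A_i (partial_i u)]; each [j] in [J] pairs with
   the same [j] in [ext_d (h_op i w)]. *)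
rewrite big_setU1//= finset.setU1K// mulrDr addrCA.
rewrite (linear_on_smoothZ _ (Aop_linear i))//; last exact: smooth_partial.
rewrite nbefore_setU1// mulrA -expr2 sqrr_sign mul1r Aop_partial//.
rewrite mulr_sumr -big_split /= big1 ?addr0// => j jJ.
have ji : j != i by apply: contraNneq iJ => <-.
rewrite (linear_on_smoothZ _ (Aop_linear i))//; last exact: smooth_partial.
rewrite h_opE !inE (negPf iJ) andbF.
rewrite (linear_on_smoothZ _ (partial_linear j))//; last exact: smooth_Aop.
rewrite (has_partial_partial cx (has_partial_Aop ji (sw _) cx)).
rewrite !mulrA sign_anticommute// mulNr.
rewrite (_ : (i |: J) :\ j = i |: (J :\ j))%SET ?addNr//.
apply/setP => k; rewrite !inE.
by case: (eqVneq k i) => // ->; rewrite eq_sym ji.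
Qed.

(** These properties are bundled because composition preserves them only jointly: linearity and
    commutation with [d] of a composite also use the first two. *)
Record chain_operator (F : diff_form R d -> diff_form R d) := ChainOperator {
  chain_ext : forall w eta, eq_form w eta -> eq_form (F w) (F eta);
  chain_smooth : forall w, smooth_coefs w -> smooth_coefs (F w);
  chain_lin : forall (a : R) w eta, smooth_coefs w -> smooth_coefs eta ->
    eq_form (F (fun J x => a * w J x + eta J x))
      (fun J x => a * F w J x + F eta J x);
  chain_ext_d : forall w, smooth_coefs w ->
    eq_form (ext_d (F w)) (F (ext_d w)) }.

Lemma chain_p_op k : chain_operator (p_op k).
Proof.
split.
- move=> w eta E J x cx; rewrite !p_opE; case: ifP => // _.
  by apply: mean_ext => // y cy; exact: E.
- exact: smooth_p_op.
- move=> a w eta sw se J x cx; rewrite !p_opE; case: ifP => _.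
    by rewrite mulr0 addr0.
  exact: mean_lin.
- exact: p_op_ext_d.
Qed.

Lemma chain_comp F G : chain_operator F -> chain_operator G ->
  chain_operator (F \o G).
Proof.
move=> [Fe Fs Fl Fd] [Ge Gs Gl Gd]; split=> /=.
- by move=> w eta E; exact/Fe/Ge.
- by move=> w sw; exact/Fs/Gs.
- move=> a w eta sw se J x cx; rewrite (Fe _ _ (Gl a w eta sw se))//.
  by apply: Fl => //; exact: Gs.
- move=> w sw J x cx; rewrite Fd//; last exact: Gs.
  by apply: Fe => //; exact: Gd.
Qed.

Lemma chain_p_prod m : chain_operator (@p_prod R d m).
Proof.
apply: big_ind => [|F G|k _]; [by split|exact: chain_comp|exact: chain_p_op].
Qed.

Lemma p_prod0 w : p_prod 0 w = w.
Proof. by rewrite /p_prod big_pred0. Qed.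

(** Composition is not commutative; [p_op i] is the innermost factor because the indices are
    enumerated in increasing order. *)
Lemma p_prodS i w : p_prod i.+1 w = p_prod i (p_op i w).
Proof.
rewrite /p_prod.
have : sorted ltn (map val (index_enum 'I_d)).
  rewrite /index_enum unlock -enumT val_enum_ord; exact: iota_ltn_sorted.
have : i \in index_enum 'I_d by exact: mem_index_enum.
elim: (index_enum 'I_d) => // k r IH.
rewrite inE /= (path_sortedE ltn_trans) => + /andP[/allP kr sr].
rewrite !big_cons ltnS.
have [ik _|ik /= ir] := eqVneq i k; last first.
  have ki : (k < i)%N by apply: kr; exact: map_f.
  by rewrite ki (ltnW ki) /= IH.
rewrite -ik leqnn ltnn /=.
(* After [k = i] all indices exceed [i], so both filtered products of the tail are the identity. *)
have rP (m : nat) : (m <= i.+1)%N ->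
    \big[(fun F G => F \o G)/idfun]_(k <- r | (k < m)%N) @p_op R d k = idfun.
  move=> mi; rewrite big_seq_cond big_pred0// => k'.
  apply/negbTE/negP => /andP[/(map_f val)/kr /= ik' k'm].
  by have := leq_trans k'm mi; rewrite ltnS leqNgt ik ik'.
by rewrite !rP.
Qed.

End FormOperators.

Theorem lemma5p1 (R : realType) (d : nat) (hd : (1 <= d)%N)
    (l : nat) (hl : (l <= d)%N) (omega : diff_form R d)
    (homega : smooth_form l omega) :
  eq_form (ext_d (H_op omega) + H_op (ext_d omega)) (omega - P_op omega).
Proof.
have sw : smooth_coefs omega.
  move=> J; have [h0 h1] := homega J; have [/h0//|/eqP/h1 J0] := eqVneq #|J| l.
  (* Coefficients of other degrees vanish on the cube, which is all that smoothness sees. *)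
  by apply: smooth_ext (@smooth_cst R d 0) => x cx; rewrite J0.
have sh i := smooth_h_op i sw; have sd := smooth_ext_d sw.
have sph (i : 'I_d) := chain_smooth (chain_p_prod R d i) (sh i).
move=> J x cx.
rewrite -[LHS]/(ext_d (H_op omega) J x + H_op (ext_d omega) J x).
rewrite -[RHS]/(omega J x - P_op omega J x).
have -> : ext_d (H_op omega) J x =
    \sum_(i < d) ext_d (p_prod i (h_op i omega)) J x.
  rewrite ext_dE; under [RHS]eq_bigr do rewrite ext_dE.
  rewrite exchange_big /=; apply: eq_bigr => j jJ; rewrite -mulr_sumr.
  congr (_ * _); rewrite -(linear_on_smooth_sum _ (partial_linear j))//.
    by congr (partial _ _ _); apply/funext => y; rewrite /H_op diff_form_sumE.
  by move=> i _; exact: sph.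
(* The end terms of the telescoping sum are [p_prod 0], the identity, and [p_prod d], which is
   [P_op]. *)
transitivity (\sum_(i < d) (p_prod i omega J x - p_prod i.+1 omega J x));
  last first.
  rewrite -(big_mkord xpredT
    (fun i => p_prod i omega J x - p_prod i.+1 omega J x)).
  under eq_bigr do rewrite -opprB.
  rewrite sumrN (telescope_sumr (fun i => p_prod i omega J x))//.
  by rewrite opprB p_prod0.
rewrite /H_op diff_form_sumE -big_split /=; apply: eq_bigr => i _.
have ci := chain_p_prod R d i.
rewrite (chain_ext_d ci)// -[X in X + _]mul1r.
rewrite -(chain_lin ci 1 (smooth_ext_d (sh i)) (smooth_h_op i sd))//.
(* The homotopy identity holds on the cube only, so it enters under [p_prod i] through
   [chain_ext]. *)
rewrite (chain_ext ci (eta := fun J x => -1 * p_op i omega J x + omega J x))//.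
  rewrite (chain_lin ci)//; last exact: smooth_p_op.
  by rewrite p_prodS mulN1r addrC.
move=> I y cy; rewrite mul1r (homotopy_h_op i sw I cy) mulN1r addrC//.
Qed.
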